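(* Let $Y_0=\{y_k\}_{k\ge0}$ and, for a word $w=y_{s_1}\cdots y_{s_r}$ over $Y_0$, $(w)=s_1+\cdots+s_r$, $|w|=r$. Define $\mathrm{H}^-_w(N)=\sum_{N\ge n_1>\cdots>n_r>0}n_1^{s_1}\cdots n_r^{s_r}$ ($N\in\mathbb{N}$), $\operatorname{Li}^-_w(z)=\sum_{n_1>\cdots>n_r>0}n_1^{s_1}\cdots n_r^{s_r}z^{n_1}$ ($|z|<1$), with $\mathrm{H}^-_{1_{Y_0^*}}=\operatorname{Li}^-_{1_{Y_0^*}}=1$, and set $C^-_{1_{Y_0^*}}=1$ and, for $w$ nonempty, $C^-_w=\prod_{w=uv,\ v\neq 1_{Y_0^*}}((v)+|v|)^{-1}$ (product over all factorizations $w=uv$ with $v$ a nonempty suffix). Consider the noncommutative series $\mathrm{H}^-=\sum_w \mathrm{H}^-_w\,w$, $\mathrm{L}^-=\sum_w\operatorname{Li}^-_w\,w$, $C^-=\sum_w C^-_w\,w$, $\Theta(t)=\sum_w t^{|w|+(w)}w$ and $\Lambda(t)=\sum_w(|w|+(w))!\,t^{|w|+(w)}w$. Then, coefficientwise, $$\lim_{N\to+\infty}\Theta^{\odot-1}(N)\odot\mathrm{H}^-(N)=\lim_{z\to1}\Lambda^{\odot-1}((1-z)^{-1})\odot\mathrm{L}^-(z)=C^-,$$ i.e. for every $w\in Y_0^*$, $\lim_{N\to\infty}N^{-((w)+|w|)}\mathrm{H}^-_w(N)=C^-_w$ and $\lim_{z\to1}(1-z)^{(w)+|w|}\operatorname{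Li}^-_w(z)/((w)+|w|)!=C^-_w$.
   Context: $\odot$ is the Hadamard (coefficientwise) product of noncommutative series, $\langle S\odot T|w\rangle=\langle S|w\rangle\langle T|w\rangle$, and $\Theta^{\odot-1},\Lambda^{\odot-1}$ are the inverses for $\odot$ (coefficients inverted). The limit $z\to1$ is taken with $|z|<1$. *)

(* Defs.v *)
From HB Require Import structures.
From mathcomp Require Import all_boot all_order all_algebra.
From mathcomp Require Import all_classical all_reals all_analysis.
From mathcomp Require Import complex.

Set Implicit Arguments.
Unset Strict Implicit.
Unset Printing Implicit Defensive.

Import Order.TTheory GRing.Theory Num.Theory.
Import numFieldNormedType.Exports.

Local Open Scope classical_set_scope.
Local Open Scope ring_scope.

(* The named field is what gives access to the metric topology: instances are
   inferred for abstract numeric fields, not for the bare type [R[i]]. *)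
Definition Cplx (R : realType) : numClosedFieldType := (complex R).

(* The letter y_k is encoded by k : nat, so the empty list is the empty word,
   [size w] is the length |w| and [sumn w] is the weight (w). *)
Definition word : Type := seq nat.

Definition degree (w : word) : nat := (sumn w + size w)%N.

(* A noncommutative series S is its coefficient function: S w = <S|w>. *)
Definition ncseries (K : Type) : Type := word -> K.

Definition hadamard (K : comUnitRingType) (S T : ncseries K) : ncseries K :=
  fun w => S w * T w.

(* This is the inverse for [hadamard] when all the coefficients are units. *)
Definition hadamard_inv (K : comUnitRingType) (S : ncseries K) : ncseries K :=
  fun w => (S w)^-1.

(* N >= n_1 > ... > n_r > 0; the bound n_1 <= N comes from the type 'I_N.+1. *)
Definition decreasing_pos (r N : nat) (n : r.-tuple 'I_N.+1) : bool :=
  sorted gtn (rcons (map val n) 0%N).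

Definition monomial_at (w : word) (N : nat) (n : (size w).-tuple 'I_N.+1) : nat :=
  (\prod_(i < size w) tnth n i ^ nth 0 w i)%N.

(* On the empty word, the only tuple is the empty one and the value is 1. *)
Definition Hminus (w : word) (N : nat) : nat :=
  (\sum_(n : (size w).-tuple 'I_N.+1 | decreasing_pos n) monomial_at n)%N.

(* On the empty word, [head] returns 0 and the value is z ^+ 0 = 1. *)
Definition Liminus_partial (K : comUnitRingType) (w : word) (z : K) (N : nat) : K :=
  \sum_(n : (size w).-tuple 'I_N.+1 | decreasing_pos n)
    (monomial_at n)%:R * z ^+ head 0%N (map val n).

(* The sum of the series for |z| < 1; it is not meaningful elsewhere. *)
Definition Liminus (R : realType) (w : word) (z : Cplx R) : Cplx R :=
  limn (Liminus_partial w z).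

(* The factorizations w = uv with v nonempty are u = take i w, v = drop i w,
   for i < size w. *)
Definition Cminus (K : fieldType) (w : word) : K :=
  \prod_(i < size w) ((degree (drop i w))%:R)^-1.

Definition Hseries (K : comUnitRingType) (N : nat) : ncseries K :=
  fun w => (Hminus w N)%:R.

Definition Lseries (R : realType) (z : Cplx R) : ncseries (Cplx R) :=
  fun w => Liminus w z.

Definition Cseries (K : fieldType) : ncseries K := fun w => Cminus K w.

Definition Theta (K : comUnitRingType) (t : K) : ncseries K :=
  fun w => t ^+ degree w.

Definition Lambda (K : comUnitRingType) (t : K) : ncseries K :=
  fun w => (degree w)`!%:R * t ^+ degree w.

Definition unit_disc (R : realType) : set (Cplx R) := [set z | `|z| < 1].

Definition coefwise_cvg (K : numFieldType) (I : Type) (F : set_system I)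
    (S : I -> ncseries K) (L : ncseries K) : Prop :=
  forall w : word, S i w @[i --> F] --> L w.

(* Main.v *)
(* Expanded in the basis n |-> 'C(n + j, j), the sequence H^-_w is given by a
   polynomial P_w: H^-_w(N) = \sum_j P_w`_j 'C(N + j, j). Multiplication by n + 1 and
   summation over n < N act on such expansions as p |-> X ((X - 1) p)' and
   p |-> (X - 1) p, so P_{y_k w} comes from P_w by k applications of the former and one
   of the latter; hence P_w has degree d = (w) + |w| and leading coefficient d! C^-_w.
   Since \sum_n 'C(n + j, j) z^n = (1 - z)^-(j+1), also Li^-_w(z) = P_w(1/(1 - z)).
   Both limits read off the leading coefficient, as 'C(N + j, j) ~ N^j / j!. Being
   polynomial in 1/(1 - z), Li^-_w has this limit without any restriction on the way z
   approaches 1. *)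

Require Import Defs.
From HB Require Import structures.
From mathcomp Require Import all_boot all_order all_algebra.
From mathcomp Require Import all_classical all_reals all_analysis.
From mathcomp Require Import complex.
From mathcomp Require Import ring.
Import Order.TTheory GRing.Theory Num.Theory.
Import numFieldNormedType.Exports.
Local Open Scope classical_set_scope.
Local Open Scope ring_scope.

Set Implicit Arguments.
Unset Strict Implicit.
Unset Printing Implicit Defensive.

(** * Recursion of the nested sums on the first letter *)

Lemma big_tuple_cons (V : nmodType) (T : finType) (n : nat) (P : pred (n.+1.-tuple T))
    (F : n.+1.-tuple T -> V) :
  \sum_(t | P t) F t =
  \sum_(x : T) \sum_(t : n.-tuple T | P [tuple of x :: t]) F [tuple of x :: t].
Proof.
rewrite pair_big_dep /=.
rewrite (reindex (fun p : T * n.-tuple T => [tuple of p.1 :: p.2])) /=; first exact: eq_bigl.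
exists (fun t : n.+1.-tuple T => (thead t, [tuple of behead t])) => [[x t] _|t _] /=.
  by rewrite theadE; congr (_, _); apply: val_inj.
by rewrite [RHS]tuple_eta.
Qed.

Lemma monomial_at_cons (k : nat) (w : word) (N : nat) (x : 'I_N.+1)
    (t : (size w).-tuple 'I_N.+1) :
  @monomial_at (k :: w) N [tuple of x :: t] = (x ^ k * monomial_at t)%N.
Proof.
rewrite /monomial_at big_ord_recl tnth0; congr (_ * _)%N.
by apply: eq_bigr => i _; rewrite tnthS.
Qed.

(* The bound variable m stands for n_1 - 1, so that the inner sum is over n_2 <= m. *)
Fixpoint nested_sum (w : word) (B : nat) : nat :=
  if w is k :: w' then (\sum_(m < B) m.+1 ^ k * nested_sum w' m)%N else 1%N.

Lemma path_gtn_ltn (N M : nat) (s : seq 'I_N.+1) :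
  (N < M)%N -> path gtn M (rcons (map val s) 0%N) = sorted gtn (rcons (map val s) 0%N).
Proof.
by case: s => [|x s] NM /=; [rewrite (leq_ltn_trans _ NM)|rewrite (leq_trans (ltn_ord x))].
Qed.

(** The bound [M] moves while the index type stays ['I_N.+1]: once n_1 is chosen, the remaining
    entries keep their type and are bounded by n_1 - 1. *)
Lemma sum_monomial_at (w : word) (N M : nat) : (M <= N)%N ->
  (\sum_(t : (size w).-tuple 'I_N.+1 | path gtn M.+1 (rcons (map val t) 0)) monomial_at t)%N
  = nested_sum w M.
Proof.
elim: w M => [|k w IHw] M MN.
  rewrite (big_pred1 [tuple]) => [|t]; first by rewrite /monomial_at big_ord0.
  by rewrite tuple0 /= eqxx.
rewrite big_tuple_cons /=.
transitivity (\sum_(x < N.+1 | (0 < x < M.+1)%N) x ^ k * nested_sum w x.-1)%N.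
  rewrite [RHS]big_mkcond /=; apply: eq_bigr => x _.
  case: ifP => [/andP[x0 xM]|/negbT xM]; last first.
    (* The value [x = 0] is excluded because at least the closing 0 of the path would have to lie
       strictly below it. *)
    rewrite big1 // => t /andP[xM' pt]; case/negP: xM; rewrite xM' andbT.
    by case: (val x) pt => //; case: (map _ t).
  rewrite -IHw; last by rewrite (leq_trans (leq_pred _)) // -ltnS.
  rewrite big_distrr /= prednK//; apply: eq_big => [t|t _]; first by rewrite xM.
  exact: monomial_at_cons.
rewrite -(big_mkord (fun x => 0 < x < M.+1)%N (fun x => x ^ k * nested_sum w x.-1))%N.
rewrite big_mkcond big_nat_recl//= add0n -big_mkcond /=.
rewrite -[RHS](big_mkord xpredT (fun m => m.+1 ^ k * nested_sum w m))%N.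
by rewrite [RHS](big_nat_widen 0 M N xpredT)//.
Qed.

Lemma Hminus_nested_sum (w : word) (N : nat) : Hminus w N = nested_sum w N.
Proof.
rewrite -(@sum_monomial_at w N)//; apply: eq_bigl => t.
by rewrite path_gtn_ltn.
Qed.

Lemma Hminus_cons (k : nat) (w : word) (N : nat) :
  Hminus (k :: w) N = (\sum_(m < N) m.+1 ^ k * Hminus w m)%N.
Proof.
by rewrite Hminus_nested_sum; apply: eq_bigr => m _; rewrite Hminus_nested_sum.
Qed.

Lemma Liminus_partial_nil (K : comUnitRingType) (z : K) (N : nat) :
  Liminus_partial [::] z N = 1.
Proof.
rewrite /Liminus_partial (big_pred1 [tuple]) => [|t].
  by rewrite /monomial_at big_ord0 mulr1.
by rewrite /decreasing_pos tuple0 /= eqxx.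
Qed.

Lemma Liminus_partial_cons (K : comUnitRingType) (k : nat) (w : word) (z : K) (N : nat) :
  Liminus_partial (k :: w) z N =
  \sum_(m < N) (m.+1 ^ k * Hminus w m)%:R * z ^+ m.+1.
Proof.
rewrite /Liminus_partial big_tuple_cons /= big_ord_recl big1 ?add0r => [|t]; last first.
  by rewrite /decreasing_pos/=; case: (map _ t).
apply: eq_bigr => m _; rewrite -mulr_suml -natr_sum; congr (_%:R * _).
rewrite Hminus_nested_sum -(@sum_monomial_at w N m (ltnW (ltn_ord m))) big_distrr/=.
apply: eq_bigr => t _; exact: monomial_at_cons.
Qed.

(** * Polynomials as expansions in the basis 'C(n + j, j) *)

Lemma poly_linear_sum (K : nzRingType) (f : {poly K} -> K) (m : nat) (p : {poly K}) :
  scalar f -> (size p <= m)%N -> f p = \sum_(j < m) p`_j * f 'X^j.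
Proof.
move=> fl /take_poly_id pm.
pose F : {linear {poly K} -> K | *%R} := HB.pack f (GRing.isLinear.Build _ _ _ _ f fl).
rewrite -{1}pm /take_poly poly_def -[f]/(F : _ -> _) linear_sum.
by apply: eq_bigr => j _; rewrite linearZ.
Qed.

Lemma poly_linear_ext (K : nzRingType) (f g : {poly K} -> K) :
  scalar f -> scalar g -> (forall j, f 'X^j = g 'X^j) -> f =1 g.
Proof.
move=> fl gl fg p; rewrite (poly_linear_sum fl (leqnn _)) (poly_linear_sum gl (leqnn _)).
by apply: eq_bigr => j _; rewrite fg.
Qed.

(* This is \sum_j p`_j 'C(n + j, j), in a form whose linearity in p is immediate. *)
Definition binom_eval (K : nzRingType) (n : nat) (p : {poly K}) : K :=
  (('X^n * p)^`N(n)).[1].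

Lemma binom_eval_scalar (K : comNzRingType) (n : nat) : scalar (@binom_eval K n).
Proof.
move=> a p q; rewrite /binom_eval mulrDr -scalerAr.
by rewrite linearP /= hornerD hornerZ.
Qed.

Lemma binom_evalXn (K : nzRingType) (n j : nat) :
  binom_eval n 'X^j = 'C(n + j, j)%:R :> K.
Proof.
rewrite /binom_eval -exprD nderivnXn hornerMn hornerXn expr1n.
by rewrite -[in RHS](bin_sub (leq_addl n j)) addnK.
Qed.

(* The action of multiplication by n + 1 on expansions in the basis 'C(n + j, j),
   because (n + 1) 'C(n + j, j) = (j + 1) 'C(n + j + 1, j + 1) - j 'C(n + j, j). *)
Definition mul_succ_op (K : nzRingType) (p : {poly K}) : {poly K} :=
  'X * (('X - 1) * p)^`().

Lemma mul_succ_op_linear (K : comNzRingType) : linear (@mul_succ_op K).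
Proof.
by move=> a p q; rewrite /mul_succ_op mulrDr -scalerAr linearP mulrDr -scalerAr.
Qed.

Lemma binom_eval_mul_succ (K : comNzRingType) (n : nat) (p : {poly K}) :
  binom_eval n (mul_succ_op p) = n.+1%:R * binom_eval n p.
Proof.
move: p; apply: poly_linear_ext => [a p q|a p q|j].
- by rewrite mul_succ_op_linear binom_eval_scalar.
- by rewrite binom_eval_scalar mulrDr mulrCA.
(* The final [+ 0] gives the shape [a *: p + q] at both levels, so that [binom_eval_scalar] applies
   twice. *)
have -> : mul_succ_op 'X^j = j.+1%:R *: 'X^(j.+1) + (- j%:R *: 'X^j + 0) :> {poly K}.
  rewrite /mul_succ_op mulrBl mul1r -exprS derivB !derivXn mulrBr addr0 scaleNr.
  by case: j => [|j]; rewrite !mulrnAr -!exprS !scaler_nat.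
rewrite !binom_eval_scalar !binom_evalXn.
have -> : binom_eval n 0 = 0 :> K by rewrite /binom_eval mulr0 linear0 horner0.
rewrite addr0 mulNr -!natrM -mul_bin_diag addnS /= mulnC.
by rewrite -mulnC -natrB ?leq_mul2r ?(leq_trans (leq_addl n j))?orbT // -mulnBl -addSn addnK.
Qed.

(** Telescoping: the factor ['X - 1] turns 'C(n + j, j) into 'C(n + j, j + 1), which vanishes at n =
    0 and whose increment from n to n + 1 is 'C(n + j, j) by Pascal's rule. *)
Lemma binom_eval_sum (K : comNzRingType) (N : nat) (p : {poly K}) :
  \sum_(n < N) binom_eval n p = binom_eval N (('X - 1) * p).
Proof.
elim: N p => [|N IHN] p.
  by rewrite big_ord0 /binom_eval nderivn0 !(hornerE, subrr, mul0r, expr0).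
rewrite big_ord_recr IHN /=; move: p; apply: poly_linear_ext => [a p q|a p q|j].
- by rewrite mulrDr -scalerAr !binom_eval_scalar mulrDr addrACA.
- by rewrite mulrDr -scalerAr !binom_eval_scalar.
have E n : binom_eval n (('X - 1) * 'X^j) = 'C(n + j, j.+1)%:R :> K.
  rewrite mulrBl mul1r -exprS addrC -scaleN1r binom_eval_scalar !binom_evalXn.
  by rewrite addnS binS natrD mulN1r addrC addrK.
by rewrite !E binom_evalXn addSn binS natrD.
Qed.

Lemma coef_mul_succ (K : comNzRingType) (p : {poly K}) (i : nat) :
  (mul_succ_op p)`_i.+1 = i.+1%:R * (p`_i - p`_i.+1).
Proof.
by rewrite coefXM /= coef_deriv mulrBl mul1r coefB coefXM mulr_natl.
Qed.

(** Each application raises the degree bound by one and multiplies the top coefficient by the new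
    bound, hence by (d + k)!/d! in total. The factorials are cross-multiplied since [K] is only a
    ring. *)
Lemma coef_iter_mul_succ (K : comNzRingType) (p : {poly K}) (d k : nat) :
  (size p <= d.+1)%N ->
  (size (iter k (@mul_succ_op K) p) <= (d + k).+1)%N /\
  d`!%:R * (iter k (@mul_succ_op K) p)`_(d + k) = (d + k)`!%:R * p`_d.
Proof.
move=> pd; elim: k => [|k [IHs IHc]]; first by rewrite addn0.
rewrite addnS iterS; split.
  apply/leq_sizeP => -[//|i] dki; rewrite coef_mul_succ.
  by rewrite !(leq_sizeP _ _ IHs) ?subrr ?mulr0// ltnW.
rewrite coef_mul_succ [X in _ - X](leq_sizeP _ _ IHs)// subr0 mulrCA IHc.
by rewrite factS natrM mulrA.
Qed.

Definition word_poly (K : nzRingType) : word -> {poly K} :=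
  foldr (fun k p => ('X - 1) * iter k (@mul_succ_op K) p) 1.

Lemma binom_eval_iter (K : comNzRingType) (n k : nat) (p : {poly K}) :
  binom_eval n (iter k (@mul_succ_op K) p) = n.+1%:R ^+ k * binom_eval n p.
Proof.
by elim: k => [|k IHk] /=; rewrite ?mul1r// binom_eval_mul_succ IHk exprS mulrA.
Qed.

Lemma binom_eval_word_poly (K : comNzRingType) (w : word) (N : nat) :
  binom_eval N (word_poly K w) = (Hminus w N)%:R.
Proof.
elim: w N => [|k w IHw] N.
  by rewrite Hminus_nested_sum /= -(expr0 'X) (binom_evalXn _ N 0) bin0.
rewrite -binom_eval_sum Hminus_cons natr_sum; apply: eq_bigr => n _.
by rewrite binom_eval_iter IHw natrM natrX.
Qed.

(** With d the degree of [w], a new first letter k multiplies the top coefficient by (d + k)!/d!. It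
    multiplies [Cminus] by 1/(d + k + 1), the factor of the full suffix, and so (d + k + 1)! times
    [Cminus] follows the same recursion. *)
Lemma coef_word_poly (K : numFieldType) (w : word) :
  (size (word_poly K w) <= (degree w).+1)%N /\
  (word_poly K w)`_(degree w) = (degree w)`!%:R * Cminus K w.
Proof.
elim: w => [|k w [IHs IHc]].
  by rewrite /= size_poly1 coef1 /Cminus big_ord0 mulr1.
have [Ss Sc] := coef_iter_mul_succ k IHs.
set q := iter _ _ _ in Ss Sc.
have dE : degree (k :: w) = (degree w + k).+1.
  by rewrite /degree /= addnS -addnA addnC.
rewrite dE /= -/q mulrBl mul1r; split.
  apply/leq_sizeP => -[//|i] dki; rewrite coefB coefXM /=.
  by rewrite !(leq_sizeP _ _ Ss) ?subrr// ltnW.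
rewrite coefB coefXM /= [X in _ - X](leq_sizeP _ _ Ss)// subr0.
have fz n : n`!%:R != 0 :> K by rewrite pnatr_eq0 -lt0n fact_gt0.
apply: (mulfI (fz (degree w))); rewrite Sc IHc /Cminus [in RHS]big_ord_recl drop0 dE.
rewrite factS natrM /=.
have -> : \prod_(i < size w) (degree (drop (bump 0 i) (k :: w)))%:R^-1 = Cminus K w by [].
by rewrite [(_ + _).+1%:R * _]mulrC -!mulrA mulVKf ?pnatr_eq0// mulrCA.
Qed.

(** * Asymptotics of binomial coefficients and the binomial series *)

Lemma norm_squeeze0 (K : numFieldType) (u v : nat -> K) :
  (forall n, `|u n| <= v n) -> v n @[n --> \oo] --> 0 -> u n @[n --> \oo] --> 0.
Proof.
move=> uv /cvgr0Pnorm_lt v0; apply/cvgr0Pnorm_lt => e /v0.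
apply: filterS => n; apply: le_lt_trans; rewrite (le_trans (uv n))//.
by rewrite (ger0_norm (le_trans _ (uv n))).
Qed.

Lemma cvg_sum_ord (K : numFieldType) (T : Type) (F : set_system T) (m : nat)
    (f : nat -> T -> K) (l : nat -> K) :
  Filter F -> (forall j, (j < m)%N -> f j x @[x --> F] --> l j) ->
  \sum_(j < m) f j x @[x --> F] --> \sum_(j < m) l j.
Proof.
move=> FF fl.
apply: (@cvg_big K _ +%R 0 xpredT _ T F (index_enum 'I_m) (fun j => f j) (fun j => l j)) => //.
  exact: add_continuous.
by move=> j _; exact: fl.
Qed.

Lemma cvg_exprn (K : numFieldType) (T : Type) (F : set_system T) (n : nat)
    (f : T -> K) (l : K) :
  Filter F -> f x @[x --> F] --> l -> f x ^+ n @[x --> F] --> l ^+ n.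
Proof.
move=> FF fl; elim: n => [|n IHn].
  by under eq_cvg do rewrite expr0; exact: cvg_cst.
by under eq_cvg do rewrite exprS; rewrite exprS; exact: cvgM.
Qed.

Lemma cvg_harmonic_Cplx (R : realType) :
  n.+1%:R^-1 @[n --> \oo] --> (0 : Cplx R).
Proof.
apply/cvgr0Pnorm_lt => e e0.
(* A positive element of [Cplx R] is real, which reduces the claim to the real harmonic sequence. *)
have eE : e = (complex.Re e)%:C%C by rewrite RRe_real// gtr0_real.
have /cvgr0Pnorm_lt/(_ (complex.Re e)) := @cvg_harmonic R.
rewrite -ltcR -eE => /(_ e0); apply: filterS => n.
by rewrite -ltcR -eE !ger0_norm ?invr_ge0// fmorphV rmorph_nat.
Qed.

(** The hypothesis expresses the archimedean property, which an abstract numeric field may lack.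
    From j to j + 1 the quotient at n + 1 is multiplied by (1 + (j + 1)/(n + 1))/(j + 1); the
    shifted index keeps the denominator nonzero. *)
Lemma cvg_binom_div (K : numFieldType) (j : nat) :
  n.+1%:R^-1 @[n --> \oo] --> (0 : K) ->
  'C(n + j, j)%:R / n%:R ^+ j @[n --> \oo] --> (j`!%:R^-1 : K).
Proof.
move=> h0; rewrite -cvg_shiftS /=.
elim: j => [|j IHj].
  by under eq_cvg do rewrite bin0 expr0 divr1; rewrite fact0 invr1; exact: cvg_cst.
have -> : (j.+1)`!%:R^-1 = j`!%:R^-1 * (j.+1%:R^-1 * (1 + j.+1%:R * 0)) :> K.
  by rewrite mulr0 addr0 mulr1 factS natrM invfM mulrC.
under eq_cvg => n.
  have -> : 'C(n.+1 + j.+1, j.+1)%:R / n.+1%:R ^+ j.+1 =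
      'C(n.+1 + j, j)%:R / n.+1%:R ^+ j * (j.+1%:R^-1 * (1 + j.+1%:R * n.+1%:R^-1)) :> K.
    have := mul_bin_diag (n.+1 + j).+1 j; move=> /(congr1 (fun x => x%:R : K)).
    rewrite /= !natrM => E.
    rewrite addnS.
    have -> : 'C((n.+1 + j).+1, j.+1)%:R =
        (n.+1 + j).+1%:R * 'C(n.+1 + j, j)%:R / j.+1%:R :> K.
      by rewrite E mulrC mulKf// pnatr_eq0.
    have n0 : n.+1%:R != 0 :> K by rewrite pnatr_eq0.
    rewrite -[X in X%:R * _](addnS n.+1) natrD exprS.
    have := expf_neq0 j n0; have : j.+1%:R != 0 :> K by rewrite pnatr_eq0.
    move: (n.+1%:R ^+ j) n0; move: (j.+1%:R) (n.+1%:R) => a b p b0 a0 p0.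
    by field; rewrite a0 b0.
  over.
apply: cvgM; first exact: IHj.
apply: cvgMl_tmp; apply: cvgD; [exact: cvg_cst|exact: cvgMl_tmp].
Qed.

Lemma sum_geometric (K : pzRingType) (N : nat) (z : K) :
  (1 - z) * \sum_(n < N) z ^+ n = 1 - z ^+ N.
Proof. by rewrite -opprB mulNr -subrX1 opprB. Qed.

(** Multiplication by 1 - z takes differences of coefficients, which Pascal's rule evaluates;
    truncation leaves one boundary term. *)
Lemma sum_binom_geometric (K : comNzRingType) (j N : nat) (z : K) :
  (1 - z) * \sum_(n < N.+1) 'C(n + j.+1, j.+1)%:R * z ^+ n =
  \sum_(n < N.+1) 'C(n + j, j)%:R * z ^+ n - 'C(N + j.+1, j.+1)%:R * z ^+ N.+1.
Proof.
elim: N => [|N IHN].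
  by rewrite !big_ord_recl !big_ord0 !add0n !binn !addr0 expr0 !mulr1 mul1r.
rewrite big_ord_recr [in RHS]big_ord_recr /= mulrDr IHN.
rewrite (addnS N.+1 j) binS addSn -addnS natrD !exprS; ring.
Qed.

(** A single term is at most the partial sum, and the partial sums are bounded by induction on [j],
    the boundary terms being subtracted and nonnegative. *)
Lemma binom_geometric_bound (K : numFieldType) (j n : nat) (r : K) :
  0 <= r -> r < 1 -> 'C(n + j, j)%:R * r ^+ n <= (1 - r) ^- j.+1.
Proof.
move=> r0 r1; have r1' : 0 < 1 - r by rewrite subr_gt0.
have S i N : \sum_(n < N.+1) 'C(n + i, i)%:R * r ^+ n <= (1 - r) ^- i.+1.
  elim: i => [|i IHi].
    rewrite -div1r ler_pdivlMr// mulrC.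
    under eq_bigr do rewrite bin0 mul1r.
    by rewrite sum_geometric gerBl exprn_ge0.
  rewrite exprS invfM mulrC ler_pdivlMr// mulrC sum_binom_geometric.
  by rewrite (le_trans _ IHi)// gerBl mulr_ge0// exprn_ge0.
apply: le_trans (S j n); rewrite big_ord_recr /= lerDr sumr_ge0// => i _.
by rewrite mulr_ge0// exprn_ge0.
Qed.

(* The next binomial coefficient gains a factor n + 1, while its product with
   |z|^n is still bounded. *)
Lemma cvg_binom_geometric0 (K : numFieldType) (j : nat) (z : K) :
  n.+1%:R^-1 @[n --> \oo] --> (0 : K) -> `|z| < 1 ->
  'C(n + j, j)%:R * z ^+ n @[n --> \oo] --> (0 : K).
Proof.
move=> h0 z1.
apply: (@norm_squeeze0 _ _ (fun n => j.+1%:R * (1 - `|z|) ^- j.+2 * n.+1%:R^-1)); last first.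
  by rewrite -[X in _ --> X](mulr0 (j.+1%:R * (1 - `|z|) ^- j.+2)); exact: cvgMl_tmp.
move=> n; rewrite normrM normrX normr_nat ler_pdivlMr ?ltr0n//.
apply: (@le_trans _ _ (j.+1%:R * ('C(n + j.+1, j.+1)%:R * `|z| ^+ n))); last first.
  by rewrite ler_wpM2l// binom_geometric_bound.
rewrite mulrAC !mulrA ler_wpM2r ?exprn_ge0// -!natrM ler_nat addnS -mul_bin_diag.
by rewrite mulnC leq_mul2r ltnS leq_addr orbT.
Qed.

(** Dividing the truncated identities by 1 - z gives an induction on [j]; each [z * 0] in the proof
    is the limit of a boundary term. *)
Lemma cvg_sum_binom_geometric (K : numFieldType) (j : nat) (z : K) :
  n.+1%:R^-1 @[n --> \oo] --> (0 : K) -> `|z| < 1 ->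
  \sum_(n < N) 'C(n + j, j)%:R * z ^+ n @[N --> \oo] --> ((1 - z) ^- j.+1 : K).
Proof.
move=> h0 z1; have z1' : 1 - z != 0.
  by rewrite subr_eq0; apply: contraTneq z1 => <-; rewrite normr1 ltxx.
rewrite -cvg_shiftS /=; elim: j => [|j IHj].
  have -> : (1 - z) ^- 1 = (1 - z)^-1 * (1 - z * 0) by rewrite mulr0 subr0 mulr1.
  under eq_cvg => N.
    have -> : \sum_(n < N.+1) 'C(n + 0, 0)%:R * z ^+ n =
        (1 - z)^-1 * (1 - z * ('C(N + 0, 0)%:R * z ^+ N)).
      under eq_bigr do rewrite bin0 mul1r.
      by rewrite bin0 mul1r -exprS -sum_geometric mulKf.
    over.
  apply: cvgMl_tmp; apply: cvgB; first exact: cvg_cst.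
  by apply: cvgMl_tmp; exact: cvg_binom_geometric0.
have -> : (1 - z) ^- j.+2 = (1 - z)^-1 * ((1 - z) ^- j.+1 - z * 0).
  by rewrite mulr0 subr0 exprS invfM mulrC.
under eq_cvg => N.
  have -> : \sum_(n < N.+1) 'C(n + j.+1, j.+1)%:R * z ^+ n =
      (1 - z)^-1 * (\sum_(n < N.+1) 'C(n + j, j)%:R * z ^+ n
                    - z * ('C(N + j.+1, j.+1)%:R * z ^+ N)).
    by rewrite mulrCA -exprS -sum_binom_geometric mulKf.
  over.
apply: cvgMl_tmp; apply: cvgB; first exact: IHj.
by apply: cvgMl_tmp; exact: cvg_binom_geometric0.
Qed.

(** * Generating functions and extraction of the leading coefficient *)

Lemma cvg_binom_eval_geometric (K : numFieldType) (p : {poly K}) (z : K) :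
  n.+1%:R^-1 @[n --> \oo] --> (0 : K) -> `|z| < 1 ->
  \sum_(n < N) binom_eval n p * z ^+ n @[N --> \oo] -->
    ((1 - z)^-1 * p.[(1 - z)^-1] : K).
Proof.
move=> h0 z1.
have -> : (1 - z)^-1 * p.[(1 - z)^-1] =
    \sum_(j < size p) p`_j * (1 - z) ^- j.+1.
  rewrite horner_coef big_distrr; apply: eq_bigr => j _ /=.
  by rewrite mulrCA -exprVn -exprS.
under eq_cvg => N.
  have -> : \sum_(n < N) binom_eval n p * z ^+ n =
      \sum_(j < size p) p`_j * \sum_(n < N) 'C(n + j, j)%:R * z ^+ n.
    under eq_bigr => n _ do
      rewrite (poly_linear_sum (@binom_eval_scalar K n) (leqnn _)) big_distrl.
    rewrite exchange_big /=; apply: eq_bigr => j _.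
    by rewrite big_distrr; apply: eq_bigr => n _; rewrite /= binom_evalXn mulrA.
  over.
apply: (cvg_sum_ord (f := fun j N => p`_j * \sum_(n < N) 'C(n + j, j)%:R * z ^+ n)
  (l := fun j => p`_j * (1 - z) ^- j.+1)) => j _.
by apply: cvgMl_tmp; exact: cvg_sum_binom_geometric.
Qed.

Lemma Liminus_word_poly (R : realType) (w : word) (z : Cplx R) :
  `|z| < 1 -> Liminus w z = (word_poly (Cplx R) w).[(1 - z)^-1].
Proof.
move=> z1; apply: cvg_lim => //; case: w => [|k w].
  by under eq_cvg do rewrite Liminus_partial_nil; rewrite hornerC; exact: cvg_cst.
have z1' : 1 - z != 0.
  by rewrite subr_eq0; apply: contraTneq z1 => <-; rewrite normr1 ltxx.
rewrite /= -/(word_poly _ w); set q := iter _ _ _.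
(* At x = 1/(1 - z) one has x - 1 = z x: the factor ['X - 1] provides both the shift from z^n to
   z^(n+1) and the extra 1/(1 - z) of the generating function. *)
have -> : (('X - 1) * q).[(1 - z)^-1] = z * ((1 - z)^-1 * q.[(1 - z)^-1]).
  rewrite mulrA hornerM !hornerE; congr (_ * _).
  by apply: (mulIf z1'); rewrite mulrBl mulVf// -mulrA mulVf// mulr1 mul1r subKr.
under eq_cvg => N.
  have -> : Liminus_partial (k :: w) z N = z * \sum_(n < N) binom_eval n q * z ^+ n.
    rewrite Liminus_partial_cons big_distrr; apply: eq_bigr => n _ /=.
    by rewrite binom_eval_iter binom_eval_word_poly natrM natrX exprS mulrCA.
  over.
by apply: cvgMl_tmp; apply: cvg_binom_eval_geometric => //; exact: cvg_harmonic_Cplx.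
Qed.

Lemma cvg_binom_eval_div (K : numFieldType) (p : {poly K}) (d : nat) :
  n.+1%:R^-1 @[n --> \oo] --> (0 : K) -> (size p <= d.+1)%N ->
  binom_eval n p / n%:R ^+ d @[n --> \oo] --> (p`_d / d`!%:R : K).
Proof.
move=> h0 pd; rewrite -cvg_shiftS /=.
under eq_cvg => n.
  have -> : binom_eval n.+1 p / n.+1%:R ^+ d =
      \sum_(j < d.+1) p`_j * ('C(n.+1 + j, j)%:R / n.+1%:R ^+ j * n.+1%:R^-1 ^+ (d - j)).
    rewrite (poly_linear_sum (@binom_eval_scalar K n.+1) pd) big_distrl.
    apply: eq_bigr => j _ /=; rewrite binom_evalXn -!mulrA; congr (_ * (_ * _)).
    by rewrite -!exprVn -exprD subnKC// -ltnS.
  over.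
(* Only j = d survives in the limit, since [0 ^+ (d - j)] is 1 there and 0 for j < d. *)
have -> : p`_d / d`!%:R = \sum_(j < d.+1) p`_j * (j`!%:R^-1 * 0 ^+ (d - j)).
  rewrite big_ord_recr /= subnn mulr1 big1 ?add0r// => j _.
  by rewrite expr0n subn_eq0 leqNgt ltn_ord /= !mulr0.
apply: (cvg_sum_ord
  (f := fun j n => p`_j * ('C(n.+1 + j, j)%:R / n.+1%:R ^+ j * n.+1%:R^-1 ^+ (d - j)))
  (l := fun j => p`_j * (j`!%:R^-1 * 0 ^+ (d - j)))) => j _.
apply: cvgMl_tmp; apply: cvgM.
  by have := cvg_binom_div (j := j) h0; rewrite -cvg_shiftS.
exact: cvg_exprn.
Qed.

(** Where u is nonzero, u^d p(1/u) is the reversed polynomial of p at u, whose value at 0 is the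
    coefficient of index d. *)
Lemma cvg_horner_inv (K : numFieldType) (T : Type) (F : set_system T) (p : {poly K})
    (d : nat) (u : T -> K) :
  Filter F -> (size p <= d.+1)%N -> u x @[x --> F] --> (0 : K) ->
  (\forall x \near F, u x != 0) ->
  u x ^+ d * p.[(u x)^-1] @[x --> F] --> p`_d.
Proof.
move=> FF pd u0 un0.
have -> : p`_d = \sum_(j < d.+1) p`_j * 0 ^+ (d - j).
  rewrite big_ord_recr /= subnn mulr1 big1 ?add0r// => j _.
  by rewrite expr0n subn_eq0 leqNgt ltn_ord mulr0.
have : \sum_(j < d.+1) p`_j * u x ^+ (d - j) @[x --> F] -->
    \sum_(j < d.+1) p`_j * 0 ^+ (d - j).
  apply: (cvg_sum_ord (f := fun j x => p`_j * u x ^+ (d - j))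
    (l := fun j => p`_j * 0 ^+ (d - j))) => j _.
  apply: cvgMl_tmp; exact: cvg_exprn.
apply: cvg_trans; apply: near_eq_cvg; apply: filterS un0 => x ux0.
rewrite (horner_coef_wide _ pd) big_distrr; apply: eq_bigr => j _ /=.
rewrite mulrCA; congr (_ * _).
have -> : u x ^+ d = u x ^+ (d - j) * u x ^+ j by rewrite -exprD subnK// -ltnS.
by rewrite exprVn mulfK// expf_neq0.
Qed.

Theorem theorem3 (R : realType) :
  coefwise_cvg \oo
    (fun N : nat =>
       hadamard (hadamard_inv (Theta (N%:R : Cplx R))) (Hseries (Cplx R) N))
    (Cseries (Cplx R)) /\
  coefwise_cvg (within (@unit_disc R) (nbhs (1 : Cplx R)))
    (fun z : Cplx R =>
       hadamard (hadamard_inv (Lambda ((1 - z)^-1))) (Lseries z))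
    (Cseries (Cplx R)).
Proof.
split=> w; have [sw cw] := coef_word_poly (Cplx R) w;
  have d0 : (degree w)`!%:R != 0 :> Cplx R by rewrite pnatr_eq0 -lt0n fact_gt0.
  have := cvg_binom_eval_div (@cvg_harmonic_Cplx R) sw.
  rewrite cw mulrC mulKf//; apply: cvg_trans; apply: near_eq_cvg; apply: nearW => N.
  by rewrite binom_eval_word_poly mulrC.
have -> : Cseries (Cplx R) w = (degree w)`!%:R^-1 * (word_poly (Cplx R) w)`_(degree w).
  by rewrite cw mulKf.
(* The disc serves twice: it excludes z = 1, and it is where [Liminus_word_poly] applies. *)
have disc : \forall z \near within (@unit_disc R) (nbhs (1 : Cplx R)), unit_disc z.
  exact: withinT.
have disc_neq0 : \forall z \near within (@unit_disc R) (nbhs (1 : Cplx R)), 1 - z != 0.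
  apply: filterS disc => z /= z1.
  by rewrite subr_eq0; apply: contraTneq z1 => <-; rewrite normr1 ltxx.
have u0 : 1 - z @[z --> within (@unit_disc R) (nbhs (1 : Cplx R))] --> (0 : Cplx R).
  rewrite -(subrr 1); apply: cvgB; first exact: cvg_cst.
  exact: cvg_within.
apply: cvg_trans (cvgMl_tmp (cvg_horner_inv _ sw u0 disc_neq0)).
apply: near_eq_cvg; apply: filterS disc => z z1.
rewrite /hadamard /hadamard_inv /Lambda /Lseries Liminus_word_poly//.
by rewrite invfM -exprVn invrK mulrA.
Qed.
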